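(* For all integers $m,n\ge 0$ and $k\ge 1$, the polynomial $$\left[{m+n\atop m}\right]^{\mathrm{c}k}_q:=\mathrm{CT}_z\left[(-qz;q)_m^k(-z^{-1};q)_n^k\right]$$ is unimodal, i.e. its sequence of coefficients $(a_0,a_1,\dots,a_D)$ (where $D$ is its degree in $q$) first weakly increases and then weakly decreases.
   Context: $(a;q)_n=\prod_{0\le j<n}(1-aq^j)$. For a Laurent polynomial $f(z)$ in $z$ (with coefficients polynomials in $q$), $\mathrm{CT}_z[f(z)]$ denotes its constant term in $z$. These are Andrews's generalized Gauss polynomials of the second kind. *)

(* Defs.v *)
From HB Require Import structures.
From mathcomp Require Import all_boot all_order all_algebra finmap.
From mathcomp Require Import monalg.

Set Implicit Arguments.
Unset Strict Implicit.
Unset Printing Implicit Defensive.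

Import Order.TTheory GRing.Theory Num.Theory.
Local Open Scope ring_scope.

(* The ring R[z, z^-1]. An element is a finitely supported family of
   coefficients indexed by the exponents of z in int; the product is the
   convolution. The library's ring structure on {malg R[K]} is not available
   for K = int, because its monomTypes have no invertible element but 1. *)
Definition laurent (R : comNzRingType) : Type := {malg R[int]}.

Section LaurentRing.
Variable R : comNzRingType.

HB.instance Definition _ := GRing.Zmodule.on (laurent R).

Implicit Types (f g h : laurent R) (c d : R) (i j : int).

Definition lmonom c i : laurent R := << c *g i >>.

Definition lcoef f i : R := mcoeff i f.

Definition lmul f g : laurent R :=
  \sum_(i <- msupp f) \sum_(j <- msupp g) lmonom (lcoef f i * lcoef g j) (i + j).

Definition const_term f : R := lcoef f 0.

Lemma lcoef_monom c i j : lcoef (lmonom c i) j = if i == j then c else 0.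
Proof. by rewrite /lcoef /lmonom mcoeffU; case: eqP. Qed.

Lemma lcoefP f g : (forall i, lcoef f i = lcoef g i) -> f = g.
Proof. by move=> e; apply/malgP. Qed.

Lemma lcoefD f g i : lcoef (f + g) i = lcoef f i + lcoef g i.
Proof. exact: mcoeffD. Qed.

Lemma lcoef0 i : lcoef 0 i = 0.
Proof. exact: mcoeff0. Qed.

Lemma lmonom0 i : lmonom 0 i = 0.
Proof. by apply: lcoefP => j; rewrite lcoef_monom lcoef0 if_same. Qed.

Lemma lmonomD c d i : lmonom (c + d) i = lmonom c i + lmonom d i.
Proof.
by apply: lcoefP => j; rewrite lcoefD !lcoef_monom; case: eqP; rewrite ?addr0.
Qed.

Lemma laurentE f : f = \sum_(i <- msupp f) lmonom (lcoef f i) i.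
Proof. exact: monalgE. Qed.

Lemma laurent_ind (P : laurent R -> Prop) :
  P 0 -> (forall f g, P f -> P g -> P (f + g)) ->
  (forall c i, P (lmonom c i)) -> forall f, P f.
Proof.
by move=> P0 PD PU f; rewrite [f]laurentE; apply: big_ind => // i _; apply: PU.
Qed.

Lemma lmulEw (A B : {fset int}) f g :
  (msupp f `<=` A)%fset -> (msupp g `<=` B)%fset ->
  lmul f g =
    \sum_(i <- A) \sum_(j <- B) lmonom (lcoef f i * lcoef g j) (i + j).
Proof.
move=> sA sB; rewrite /lmul.
have -> : \sum_(i <- msupp f) \sum_(j <- msupp g)
            lmonom (lcoef f i * lcoef g j) (i + j)
        = \sum_(i <- msupp f) \sum_(j <- B)
            lmonom (lcoef f i * lcoef g j) (i + j).
  apply: eq_bigr => i _; apply: big_fset_incl => // j _ /mcoeff_outdom.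
  by rewrite /lcoef => ->; rewrite mulr0 lmonom0.
apply: big_fset_incl => // i _ /mcoeff_outdom; rewrite /lcoef => ->.
by rewrite big1 // => j _; rewrite mul0r lmonom0.
Qed.

Lemma lmulC : commutative lmul.
Proof.
move=> f g; rewrite /lmul exchange_big; apply: eq_bigr => i _.
by apply: eq_bigr => j _; rewrite mulrC addrC.
Qed.

Lemma lmulDl : left_distributive lmul +%R.
Proof.
move=> f g h; pose A := (msupp f `|` msupp g `|` msupp (f + g)%R)%fset.
have sf : (msupp f `<=` A)%fset by rewrite /A -fsetUA fsubsetUl.
have sg : (msupp g `<=` A)%fset by rewrite /A fsetUAC fsubsetUr.
have sD : (msupp (f + g)%R `<=` A)%fset by rewrite fsubsetUr.
rewrite (lmulEw sf (fsubset_refl (msupp h))).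
rewrite (lmulEw sg (fsubset_refl (msupp h))).
rewrite (lmulEw sD (fsubset_refl (msupp h))).
rewrite -big_split; apply: eq_bigr => i _; rewrite -big_split.
by apply: eq_bigr => j _; rewrite lcoefD mulrDl lmonomD.
Qed.

Lemma lmulDr : right_distributive lmul +%R.
Proof. by move=> f g h; rewrite lmulC lmulDl !(lmulC f). Qed.

Lemma lmul0l : left_zero 0 lmul.
Proof. by move=> f; rewrite /lmul msupp0 big_seq_fset0. Qed.

Lemma lmul0r : right_zero 0 lmul.
Proof. by move=> f; rewrite lmulC lmul0l. Qed.

Lemma lmul_monom c d i j : lmul (lmonom c i) (lmonom d j) = lmonom (c * d) (i + j).
Proof.
rewrite (lmulEw (A := [fset i]%fset) (B := [fset j]%fset)) ?msuppU_le //.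
by rewrite !big_seq_fset1 !lcoef_monom !eqxx.
Qed.

Lemma lmulA : associative lmul.
Proof.
move=> f g h.
elim/laurent_ind: f => [|f1 f2 IH1 IH2|c i]; first by rewrite !lmul0l.
  by rewrite !lmulDl IH1 IH2.
elim/laurent_ind: g => [|g1 g2 IH1 IH2|d j]; first by rewrite !(lmul0l, lmul0r).
  by rewrite !(lmulDl, lmulDr) IH1 IH2.
elim/laurent_ind: h => [|h1 h2 IH1 IH2|e l]; first by rewrite !lmul0r.
  by rewrite !lmulDr IH1 IH2.
by rewrite !lmul_monom mulrA addrA.
Qed.

Lemma lmul1l : left_id (lmonom 1 0) lmul.
Proof.
elim/laurent_ind => [|f g IHf IHg|c i]; first by rewrite lmul0r.
  by rewrite lmulDr IHf IHg.
by rewrite lmul_monom mul1r add0r.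
Qed.

Lemma lone_neq0 : lmonom 1 0 != 0.
Proof.
apply/eqP => /(congr1 (lcoef^~ 0)) /eqP.
by rewrite lcoef_monom eqxx lcoef0 oner_eq0.
Qed.

HB.instance Definition _ := GRing.Zmodule_isComNzRing.Build (laurent R)
  lmulA lmulC lmul1l lmulDl lone_neq0.

Definition lconst c : laurent R := lmonom c 0.
Definition lz : laurent R := lmonom 1 1.
Definition lzV : laurent R := lmonom 1 (-1).

Lemma lmulE f g : f * g = lmul f g.
Proof. by []. Qed.

Lemma lz_mulV : lz * lzV = 1.
Proof. by rewrite lmulE lmul_monom mulr1. Qed.

Lemma lcoefM f g l :
  lcoef (f * g) l =
  \sum_(i <- msupp f) \sum_(j <- msupp g | i + j == l) lcoef f i * lcoef g j.
Proof.
rewrite lmulE /lmul /lcoef raddf_sum /=; apply: eq_bigr => i _.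
rewrite raddf_sum /= [RHS]big_mkcond; apply: eq_bigr => j _.
exact: lcoef_monom.
Qed.

End LaurentRing.

Definition qpoch (A : comNzRingType) (a q : A) (n : nat) : A :=
  \prod_(0 <= j < n) (1 - a * q ^+ j).

(* The variable q of Z[q] is 'X : {poly int}. *)
Definition gauss_poly2 (m n k : nat) : {poly int} :=
  let q := lconst ('X : {poly int}) in
  let z := lz {poly int} in
  let zV := lzV {poly int} in
  const_term (qpoch (- (q * z)) q m ^+ k * qpoch (- zV) q n ^+ k).

(* A polynomial coerces to its coefficient sequence a_0, ..., a_D, whose last
   item is the leading coefficient. *)
Definition unimodal (s : seq int) : Prop :=
  exists t : nat,
    (forall i : nat, (i < t)%N -> (i.+1 < size s)%N -> s`_i <= s`_i.+1) /\
    (forall i : nat, (t <= i)%N -> (i.+1 < size s)%N -> s`_i.+1 <= s`_i).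

(* Main.v *)
Require Import Defs.
From mathcomp Require Import all_boot all_order all_algebra.
From mathcomp Require Import perm realalg ring zify.

(** Since [1 + q^j / z = (q^j / z) (1 + q^(-j) z)], the product whose constant
    term is taken equals, up to a monomial in [q] and [z], the product of the
    [(1 + q^i z)^k] over [m + n] consecutive values of [i]. Hence the
    coefficients count the [nk]-subsets [S] of [{0, ..., N-1} x {1, ..., k}],
    [N = m + n], by the sum of their first coordinates. These are the weight
    multiplicities of the exterior power of degree [nk] of [k] copies of the
    [N]-dimensional irreducible representation of sl2. As in Proctor's proof of
    the unimodality of Gaussian coefficients, put weight
    [sqrt ((i+1) (N-1-i))] on each move of an element of [S] from [i] to an
    unoccupied [i+1]; the resulting raising operator [U] and its transpose [D]
    satisfy [|U x|^2 - |D x|^2 = sum_S h(S) x(S)^2] with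
    [h(S) = |S| (N-1) - 2 sum(S)]. So [U] is injective on each weight space
    below the middle and, symmetrically, [D] above it. *)

Set Implicit Arguments.
Unset Strict Implicit.
Unset Printing Implicit Defensive.

Import Order.TTheory GRing.Theory Num.Theory.
Local Open Scope ring_scope.

(** * Comparing cardinalities through injectivity *)

(** The hypothesis gives the [A] by [B] submatrix of [L] a trivial left kernel, so its rank is
    [#|A|], at most its number of columns. *)
Lemma leq_card_kernel (F : fieldType) (X : finType) (A B : {set X})
    (L : X -> X -> F) :
  (forall x : X -> F, (forall i, i \notin A -> x i = 0) ->
     (forall j, j \in B -> \sum_i x i * L i j = 0) -> forall i, x i = 0) ->
  (#|A| <= #|B|)%N.
Proof.
move=> injL; pose M := \matrix_(i < #|A|, j < #|B|) L (enum_val i) (enum_val j).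
suff /eqP <- : row_free M by exact: rank_leq_col.
rewrite -kermx_eq0; apply/eqP/row_matrixP => l; rewrite row0.
set v := row l _; have vM : v *m M = 0 by rewrite /v -row_mul mulmx_ker row0.
(* Extension of [v] by zero outside [A]. *)
pose x S := \sum_(i < #|A| | enum_val i == S) v 0 i.
have xE i : x (enum_val i) = v 0 i.
  rewrite /x (big_pred1 i) // => j; exact: (inj_eq enum_val_inj).
apply/rowP => i; rewrite [RHS]mxE -xE; apply: injL => [S SA | S SB].
  by apply: big1 => j /eqP eS; case/negP: SA; rewrite -eS enum_valP.
have /rowP/(_ (enum_rank_in SB S)) := vM; rewrite !mxE => vM0.
rewrite -[RHS]vM0.
under eq_bigr => T _ do rewrite /x big_distrl /= big_mkcond /=.
rewrite exchange_big; apply: eq_bigr => j _.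
rewrite -big_mkcond (big_pred1 (enum_val j)) ?mxE ?enum_rankK_in //.
Qed.

(** * Moves between sites and weighted transfer operators *)

Definition swap_at (T : finType) (x y : T) (S : {ffun T -> bool}) :
  {ffun T -> bool} := [ffun u => S (tperm x y u)].

Definition movable (T : finType) (x y : T) (S : {ffun T -> bool}) :=
  S x && ~~ S y.

Lemma swap_atC (T : finType) (x y : T) : swap_at x y =1 swap_at y x.
Proof. by move=> S; apply/ffunP => u; rewrite !ffunE tpermC. Qed.

Lemma swap_atK (T : finType) (x y : T) : involutive (swap_at x y).
Proof. by move=> S; apply/ffunP => u; rewrite !ffunE tpermK. Qed.

Lemma movable_swap (T : finType) (x y : T) S :
  movable x y (swap_at x y S) = movable y x S.
Proof. by rewrite /movable !ffunE tpermL tpermR. Qed.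

Section Transfer.
Variables (R : rcfType) (T E : finType).
Implicit Types (src dst : E -> T) (a : E -> R) (S : {ffun T -> bool}).

(** The terms at [S] come from the configurations that become [S] when one element moves from
    [src e] to [dst e]. Exchanging [src] and [dst] transposes the operator. *)
Definition transfer src dst a (x : {ffun T -> bool} -> R) S : R :=
  \sum_(e | movable (dst e) (src e) S) a e * x (swap_at (src e) (dst e) S).

Let gram src dst x e f : R :=
  \sum_(S | movable (dst e) (src e) S && movable (dst f) (src f) S)
     x (swap_at (src e) (dst e) S) * x (swap_at (src f) (dst f) S).

Lemma transfer_gram src dst a x :
  \sum_S transfer src dst a x S ^+ 2 =
    \sum_e \sum_f a e * a f * gram src dst x e f.
Proof.
transitivity (\sum_S \sum_e \sum_f
   if movable (dst e) (src e) S && movable (dst f) (src f) S then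
   a e * a f * (x (swap_at (src e) (dst e) S) * x (swap_at (src f) (dst f) S))
   else 0).
  apply: eq_bigr => S _; rewrite /transfer expr2 big_distrl /= big_mkcond /=.
  apply: eq_bigr => e _; case: ifP => _ /=; last by rewrite big1.
  rewrite big_distrr /= big_mkcond /=; apply: eq_bigr => f _.
  by case: ifP => // _; ring.
rewrite exchange_big; apply: eq_bigr => e _; rewrite exchange_big.
by apply: eq_bigr => f _; rewrite -big_mkcond /gram big_distrr.
Qed.

Lemma gram_diag src dst x e :
  gram src dst x e e = \sum_(S | movable (src e) (dst e) S) x S ^+ 2.
Proof.
rewrite /gram (reindex_inj (inv_inj (swap_atK (src e) (dst e)))) /=.
apply: eq_big => [S|S _]; last by rewrite swap_atK expr2.
by rewrite andbb swap_atC movable_swap.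
Qed.

(* Two distinct simultaneous moves act on four distinct sites, so performing
   both moves matches the two sums term by term. *)
Lemma gram_offdiag src dst x e f : injective src -> injective dst -> e != f ->
  gram src dst x e f = gram dst src x e f.
Proof.
move=> srcI dstI ef; rewrite /gram.
have nss : src e != src f by rewrite (inj_eq srcI).
have ndd : dst e != dst f by rewrite (inj_eq dstI).
(* If one move starts where the other ends, that site would be both occupied and empty, so both sums
   are empty. *)
have [eq1|nsd] := eqVneq (src e) (dst f).
  by rewrite !big_pred0 // => S; rewrite /movable eq1;
    case: (S (dst f)); rewrite /= ?andbF.
have [eq1|nds] := eqVneq (dst e) (src f).
  by rewrite !big_pred0 // => S; rewrite /movable eq1;
    case: (S (src f)); rewrite /= ?andbF.
have [nss' ndd' nsd' nds'] :
  [/\ src f != src e, dst f != dst e, dst f != src e & src f != dst e].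
  by rewrite ![_ == src e]eq_sym ![_ == dst e]eq_sym.
have fixe : (tperm (src e) (dst e) (src f) = src f) *
            (tperm (src e) (dst e) (dst f) = dst f) by rewrite !tpermD.
have fixf : (tperm (src f) (dst f) (src e) = src e) *
            (tperm (src f) (dst f) (dst e) = dst e) by rewrite !tpermD.
have swapC S : swap_at (src e) (dst e) (swap_at (src f) (dst f) S)
             = swap_at (src f) (dst f) (swap_at (src e) (dst e) S).
  apply/ffunP => u; rewrite !ffunE; congr (S _).
  have [->|u1] := eqVneq u (src e); first by rewrite tpermL !fixf tpermL.
  have [->|u2] := eqVneq u (dst e); first by rewrite tpermR !fixf tpermR.
  have [->|u3] := eqVneq u (src f); first by rewrite tpermL !fixe tpermL.
  have [->|u4] := eqVneq u (dst f); first by rewrite tpermR !fixe tpermR.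
  by rewrite [X in tperm _ _ X]tpermD 1?eq_sym // [in RHS]tpermD 1?eq_sym //
             !tpermD // eq_sym.
pose h S := swap_at (src e) (dst e) (swap_at (src f) (dst f) S).
have hI : injective h.
  by apply: inj_comp; apply: inv_inj; apply: swap_atK.
rewrite (reindex_inj hI); apply: eq_big => [S|S _].
  by rewrite /movable !ffunE !(tpermL, tpermR, fixe, fixf).
by rewrite /h swap_atK swapC swap_atK mulrC !(swap_atC (dst _)).
Qed.

(** Off-diagonal Gram terms cancel. In the diagonal ones, only configurations with exactly one of
    [src e], [dst e] occupied survive, with a sign. *)
Lemma transfer_norm src dst a x : injective src -> injective dst ->
  \sum_S transfer src dst a x S ^+ 2 - \sum_S transfer dst src a x S ^+ 2 =
  \sum_S x S ^+ 2 * \sum_e a e ^+ 2 * ((S (src e))%:R - (S (dst e))%:R).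
Proof.
move=> srcI dstI; rewrite !transfer_gram -sumrB.
under [RHS]eq_bigr => S _ do rewrite big_distrr /=.
rewrite exchange_big; apply: eq_bigr => e _.
rewrite -sumrB (bigD1 e) //= big1 ?addr0 => [|f fe]; last first.
  by rewrite (gram_offdiag x srcI dstI) ?subrr // eq_sym.
rewrite !gram_diag -mulrBr big_mkcond [X in _ - X]big_mkcond -sumrB big_distrr.
apply: eq_bigr => S _; rewrite /movable.
by case: (S (src e)); case: (S (dst e)) => /=; ring.
Qed.

(** Let [x] be supported on [A] with transfer zero on [B]. The last hypothesis makes the transfer
    zero everywhere, so [transfer_norm] equates a nonpositive number with a sum whose terms are
    positive wherever [x] is nonzero. Hence [x = 0]. *)
Lemma leq_card_transfer src dst (c : E -> R) (A B : {set {ffun T -> bool}}) :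
    injective src -> injective dst -> (forall e, 0 <= c e) ->
    (forall S, S \in A ->
       0 < \sum_e c e * ((S (src e))%:R - (S (dst e))%:R)) ->
    (forall S e, c e != 0 -> movable (dst e) (src e) S ->
       swap_at (src e) (dst e) S \in A -> S \in B) ->
  (#|A| <= #|B|)%N.
Proof.
move=> srcI dstI c_ge0 posA AB; pose a e := Num.sqrt (c e).
apply: (@leq_card_kernel R _ _ _ (fun S S' =>
  \sum_(e | movable (dst e) (src e) S')
     a e * (swap_at (src e) (dst e) S' == S)%:R)) => x xA xB.
have Ux0 S : transfer src dst a x S = 0.
  have [SB|SB] := boolP (S \in B); last first.
    apply: big1 => e mv; have [c0|c0] := eqVneq (c e) 0.
      by rewrite /a c0 sqrtr0 mul0r.
    by rewrite xA ?mulr0 //; apply: contraNN SB; apply: AB.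
  rewrite -[RHS](xB S SB) /transfer.
  under [RHS]eq_bigr => S' _ do rewrite big_distrr /=.
  rewrite exchange_big; apply: eq_bigr => e _.
  rewrite (bigD1 (swap_at (src e) (dst e) S)) //= eqxx mulr1 mulrC.
  by rewrite big1 ?addr0 // => S' /negPf nS'; rewrite eq_sym nS' !mulr0.
have := transfer_norm a x srcI dstI.
rewrite big1 => [|S _]; last by rewrite Ux0 expr0n.
set h := fun S : {ffun T -> bool} =>
  \sum_e c e * ((S (src e))%:R - (S (dst e))%:R).
rewrite [RHS](eq_bigr (fun S => x S ^+ 2 * h S)) => [|S _]; last first.
  by congr (_ * _); apply: eq_bigr => e _; rewrite sqr_sqrtr.
move=> normE; have ge0 S : 0 <= x S ^+ 2 * h S.
  have [SA|SA] := boolP (S \in A); last by rewrite xA // expr0n mul0r.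
  by rewrite mulr_ge0 ?sqr_ge0 ?ltW ?posA.
have : \sum_S x S ^+ 2 * h S == 0.
  rewrite eq_le sumr_ge0 // andbT -normE sub0r oppr_le0.
  by apply: sumr_ge0 => S _; apply: sqr_ge0.
rewrite psumr_eq0 // => /allP xh0 S.
have [SA|] := boolP (S \in A); last exact: xA.
have := xh0 S (mem_index_enum S); rewrite mulf_eq0 sqrf_eq0.
by rewrite [h S == 0]gt_eqF ?posA // orbF => /eqP.
Qed.

End Transfer.

Lemma sum_swap_at (T : finType) (w : T -> int) (x y : T) S : movable x y S ->
  \sum_u (swap_at x y S u)%:Z * w u = \sum_u (S u)%:Z * w u - w x + w y.
Proof.
move=> /andP[Sx Sy]; have nyx : y != x by apply: contraNneq Sy => ->.
rewrite (reindex_inj (@perm_inj _ (tperm x y))) /=.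
under eq_bigr => u _ do rewrite ffunE tpermK.
rewrite (bigD1 x) //= [in RHS](bigD1 x) //= Sx tpermL !mul1r.
rewrite [X in _ + X](eq_bigr (fun u => (S u)%:Z * w u)) => [|u ux].
  by rewrite [w x + _]addrC addrK addrC.
have [->|uy] := eqVneq u y; first by rewrite (negPf Sy) !mul0r.
by rewrite tpermD // eq_sym.
Qed.

(** * Weight spaces of the exterior power *)

Section WeightClass.
Variables (N k r : nat).
Implicit Types (u : 'I_N * 'I_k) (S : {ffun 'I_N * 'I_k -> bool}) (s : int).

Definition weight_class s : {set {ffun 'I_N * 'I_k -> bool}} :=
  [set S : {ffun 'I_N * 'I_k -> bool} |
    (\sum_(u : 'I_N * 'I_k) (S u)%:Z == r%:Z) &&
    (\sum_(u : 'I_N * 'I_k) (S u)%:Z * (u.1 : nat)%:Z == s)].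

(* The cyclic wrap-around from [N-1] to [0] is harmless: the move from [i] to
   [next i] gets weight [g i.+1], and [g N = 0]. *)
Let next u : 'I_N * 'I_k := (ordS u.1, u.2).

Let nextI : injective next.
Proof.
move=> [i c] [j d] /eqP.
by rewrite xpair_eqE => /andP[/= /eqP/ordS_inj -> /eqP ->].
Qed.

Let g (i : nat) : nat := (i * (N - i))%N.

Let g_next u : g (next u).1 = g u.1.+1.
Proof.
rewrite /g /=; have := ltn_ord u.1; rewrite leq_eqVlt => /orP[/eqP ->|lt].
  by rewrite modnn subnn muln0.
by rewrite modn_small.
Qed.

(** Summation by parts: after a shift along [next], an element of [S] at [i] contributes
    [g (i+1) - g i = N - 1 - 2i]. *)
Let weight_gap S s : S \in weight_class s ->
  \sum_(u : 'I_N * 'I_k) (g u.1.+1)%:Z * ((S u)%:Z - (S (next u))%:Z) =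
  r%:Z * (N%:Z - 1) - s * 2.
Proof.
rewrite inE => /andP[/eqP <- /eqP <-].
under eq_bigr => u _ do rewrite mulrBr.
have shift : \sum_(u : 'I_N * 'I_k) (g u.1.+1)%:Z * (S (next u))%:Z =
             \sum_(u : 'I_N * 'I_k) (g u.1)%:Z * (S u)%:Z.
  by rewrite [RHS](reindex_inj nextI); apply: eq_bigr => u _; rewrite g_next.
rewrite sumrB shift.
rewrite -sumrB !mulr_suml -sumrB; apply: eq_bigr => u _.
have lt := ltn_ord u.1; rewrite /g !PoszM -!subzn ?(ltnW lt) //.
by rewrite -addn1 PoszD; ring.
Qed.

Let mem_weight_class s x y S : movable x y S ->
  (swap_at x y S \in weight_class s) =
  (S \in weight_class (s + (x.1 : nat)%:Z - (y.1 : nat)%:Z)).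
Proof.
move=> mv; rewrite !inE (sum_swap_at (fun u => (u.1 : nat)%:Z) mv).
(* Constant weight 1 shows that a move preserves cardinality. *)
have := sum_swap_at (fun=> 1) mv; rewrite subrK.
under eq_bigr => u _ do rewrite mulr1; move=> ->.
under eq_bigr => u _ do rewrite mulr1; congr (_ && _).
by apply/eqP/eqP => [<-|->]; ring.
Qed.

Lemma leq_weight_class_incr s : s * 2 < r%:Z * (N%:Z - 1) ->
  (#|weight_class s| <= #|weight_class (s + 1)|)%N.
Proof.
move=> s_lt; apply: (@leq_card_transfer realalg _ _ id next
  (fun u => (g u.1.+1)%:R)) => // [S /weight_gap hS|S u cu mv].
  rewrite (eq_bigr (fun u => ((g u.1.+1)%:Z *
      ((S u)%:Z - (S (next u))%:Z))%:~R)) => [|u _].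
    by rewrite -rmorph_sum /= hS ltr0z subr_gt0.
  by rewrite intrM intrB.
rewrite swap_atC (mem_weight_class _ mv) /=.
have lt : (u.1.+1 < N)%N.
  rewrite ltn_neqAle ltn_ord andbT; apply: contraNneq cu => e.
  by rewrite /g e subnn muln0.
by rewrite modn_small // -addn1 PoszD addrA addrAC addrK.
Qed.

(** Exchanging source and target negates the weight gap, which makes it positive above the
    middle. *)
Lemma leq_weight_class_decr s : r%:Z * (N%:Z - 1) < (s + 1) * 2 ->
  (#|weight_class (s + 1)| <= #|weight_class s|)%N.
Proof.
move=> s_gt; apply: (@leq_card_transfer realalg _ _ next id
  (fun u => (g u.1.+1)%:R)) => // [S /weight_gap hS|S u cu mv].
  rewrite (eq_bigr (fun u => (- ((g u.1.+1)%:Z *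
      ((S u)%:Z - (S (next u))%:Z)))%:~R)) => [|u _].
    by rewrite -rmorph_sum /= sumrN hS ltr0z oppr_gt0 subr_lt0.
  by rewrite -mulrN opprB intrM intrB.
rewrite swap_atC (mem_weight_class _ mv) /=.
have lt : (u.1.+1 < N)%N.
  rewrite ltn_neqAle ltn_ord andbT; apply: contraNneq cu => e.
  by rewrite /g e subnn muln0.
by rewrite modn_small // -addn1 PoszD opprD addrA !addrK.
Qed.

End WeightClass.

(** * Expansion of the constant term over subsets *)

Lemma lmonom_prod (R : comNzRingType) (I : finType) (c : I -> R) (d : I -> int) :
  \prod_i lmonom (c i) (d i) = lmonom (\prod_i c i) (\sum_i d i).
Proof.
elim/big_rec3: _ => [//|i x y z _ ->].
by rewrite lmulE lmul_monom.
Qed.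

Lemma lconstX (R : comNzRingType) (c : R) j : lconst c ^+ j = lconst (c ^+ j).
Proof.
elim: j => [//|j IH]; rewrite !exprS IH lmulE /lconst lmul_monom.
by rewrite addr0.
Qed.

Section Expansion.
Variables (m n k : nat).
Let N := (n + m)%N.

(* For [i < n] the index [i] stands for the factor [1 + q^(n-1-i) / z], whose
   [z]-free term is the one selected by [b = true]; the other indices stand for
   the factors [1 + q^(i-n+1) z]. *)
Definition qexp (i : nat) (b : bool) : nat :=
  if (i < n)%N then (~~ b * (n.-1 - i))%N else (b * (i - n).+1)%N.

Lemma qpoch_prod :
  qpoch (- (lconst 'X * lz {poly int})) (lconst 'X) m ^+ k *
  qpoch (- lzV {poly int}) (lconst 'X) n ^+ k =
  \prod_(u : 'I_N * 'I_k) \sum_(b : bool)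
     lmonom 'X^(qexp u.1 b) (b%:Z - (u.1 < n)%N%:Z).
Proof.
rewrite -(pair_bigA _ (fun i (_ : 'I_k) => \sum_(b : bool)
     lmonom 'X^(qexp (i : 'I_N) b) (b%:Z - (i < n)%N%:Z))) /=.
under eq_bigr => i _ do rewrite prodr_const card_ord.
rewrite prodrXl -exprMn mulrC; congr (_ ^+ _).
rewrite big_split_ord /qpoch !big_mkord; congr (_ * _).
  rewrite (reindex_inj rev_ord_inj); apply: eq_bigr => i _ /=.
  rewrite big_bool /qexp ltn_ord /= mul0n mul1n subrr sub0r.
  rewrite mulNr opprK lconstX lmulE lmul_monom mul1r addr0.
  by congr (_ + lmonom _ _); congr 'X^_; lia.
apply: eq_bigr => i _ /=; rewrite big_bool /qexp /=.
rewrite ltnNge leq_addr /= addKn mul0n mul1n subr0.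
rewrite mulNr opprK lconstX !lmulE !lmul_monom mulr1 -exprS.
by rewrite addrC add0r addr0.
Qed.

Lemma gauss_poly2_coef t : (gauss_poly2 m n k)`_t =
  #|[set S : {ffun 'I_N * 'I_k -> bool} |
     (\sum_(u : 'I_N * 'I_k) ((S u)%:Z - (u.1 < n)%N%:Z) == 0) &&
     (\sum_(u : 'I_N * 'I_k) qexp u.1 (S u) == t)%N]|%:Z.
Proof.
rewrite /gauss_poly2 qpoch_prod bigA_distr_bigA /const_term /=.
under eq_bigr => S _ do rewrite lmonom_prod.
rewrite (big_morph (fun f => lcoef f 0) (fun f g => lcoefD f g 0) (lcoef0 _ 0)).
rewrite -sum1_card (big_morph Posz PoszD (erefl _)) coef_sum [RHS]big_mkcond.
apply: eq_bigr => S _; rewrite lcoef_monom inE prodrXr.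
by case: ifP => _ /=; rewrite ?coef0 // coefXn eq_sym; case: eqP.
Qed.

Lemma gauss_poly2_weight_class :
  exists s0 : int, forall t,
    (gauss_poly2 m n k)`_t = #|weight_class N k (n * k) (s0 + t%:Z)|%:Z.
Proof.
(* In both cases [qexp i b = (b - [i < n]) (i + 1 - n)]. Summing this with [|S| = n k] makes the
   [q]-exponent the coordinate sum minus this constant. *)
exists (\sum_(u : 'I_N * 'I_k) (u.1 < n)%N%:Z * ((u.1 : nat)%:Z + 1 - n%:Z) +
        (n * k)%N%:Z * (n%:Z - 1)) => t.
rewrite gauss_poly2_coef; congr Posz; apply: eq_card => S; rewrite !inE.
have -> : \sum_(u : 'I_N * 'I_k) ((S u)%:Z - (u.1 < n)%N%:Z) =
          \sum_(u : 'I_N * 'I_k) (S u)%:Z - (n * k)%N%:Z.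
  rewrite sumrB; congr (_ - _).
  rewrite -(pair_bigA _ (fun (i : 'I_N) (_ : 'I_k) => (i < n)%N%:Z)) /=.
  under eq_bigr => i _ do rewrite sumr_const card_ord.
  rewrite sumrMnl big_split_ord /=.
  under eq_bigr => i _ do rewrite ltn_ord.
  under [X in _ + X]eq_bigr => i _ do rewrite ltnNge leq_addr.
  by rewrite [X in _ + X]big1 // sumr_const card_ord addr0 -mulrnA natz.
rewrite subr_eq0; have [sumS|//] := eqVneq; rewrite -sumS /=.
rewrite -(inj_eq (can_inj absz_nat)) (big_morph Posz PoszD (erefl _)).
rewrite mulr_suml -big_split /= addrC -subr_eq -sumrB.
congr (_ == _); apply: eq_bigr => u _; rewrite /qexp.
by have := ltn_ord u.1; case: (ltnP u.1 n) => lt ltN; case: (S u) => /=; lia.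
Qed.

End Expansion.

Theorem theorem2p3 (m n k : nat) (hk : (1 <= k)%N) :
  unimodal (gauss_poly2 m n k).
Proof.
have [s0 coefE] := gauss_poly2_weight_class m n k.
have [t [t_lt t_ge]] : exists t : nat,
    (forall i : nat, (i < t)%N ->
       (s0 + i%:Z) * 2 < (n * k)%N%:Z * ((n + m)%N%:Z - 1)) /\
    (forall i : nat, (t <= i)%N ->
       (n * k)%N%:Z * ((n + m)%N%:Z - 1) < (s0 + i%:Z + 1) * 2).
  (* Here [c] is twice the middle coordinate sum; [t] is the least natural number with
     [c <= 2 (s0 + t)], hence the rounding up. *)
  move: (_ * (_ - 1)) => c; have [le|lt] := leP (c - s0 * 2) 0.
    by exists 0%N; split=> i; lia.
  by exists (uphalf `|(c - s0 * 2)%R|%N); split=> i; rewrite uphalf_half; lia.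
by exists t; split=> i i_t _; rewrite !coefE lez_nat -addn1 PoszD addrA;
  [apply/leq_weight_class_incr/t_lt | apply/leq_weight_class_decr/t_ge].
Qed.
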